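(* Let $L$ be a frame, regarded as a distributivity form over the terminal category with all (small) join presentations admissible. Extensional presentations of $L$ correspond naturally to strongly exact filters of $L$, and hence to fitted sublocales of the locale represented by $L$. The strongly exact filter $D$ gives the representative $$D\longrightarrow L\xrightarrow{\;j_D\;}\operatorname{Fix}(j_D).$$
   Context: **Distributivity forms over the terminal category $\mathbf 1$.** Such a form is a meet-semilattice $L$ with top together with a class of small join presentations $u=\bigvee_ia_i$ (each being a family with its join in $L$), called admissible, such that: (D1) unit presentations $a=\bigvee\{a\}$ are admissible and admissibility is invariant under bijective reindexing; (D2) if $u=\bigvee_ia_i$ and $a_i=\bigvee_jb_{ij}$ (all $i$) are admissible, so is $u=\bigvee_{i,j}b_{ij}$; (D3) if $u=\bigvee_ia_i$ is admissible and $c\in L$, then $u\wedge c=\bigvee_i(a_i\wedge c)$ is an admissible join presentation. A morphism is a map preserving top and binary meets and sending admissible join presentations to admissible join presentations. **Extensional presentations.** A morphism is null if it is constant at the top element. A relative kernel of $u:L\to M$ is a morphism $k:K\to L$ with $uk$ null through which every $h$ with $uh$ null factors uniquely; relative cokernels are dual. A pair $K\xrightarrow{k}L\xrightarrow{q}Q$ is short exact if $k$ is a kernel of $q$ and $q$ is a cokernel of $k$. An extensional presentation of $L$ is an isomorphism class, fixing $L$, of short exact sequences with middle term $L$. A kernel term $D\subseteq L$ carries the induced distributivity (admissible presentations of $L$ with all members and join in $D$); the quotient carries the distributivity generated by the images of the admissible presentations of $L$. **Frames.** A meet $\bigwedge_id_i$ in a frame is strongly exact if every frame homomorphism preserves it;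 a filter is strongly exact if it is closed under all strongly exact meets of its members (the improper filter is allowed). For $d\in L$, $o_d(x)=d\Rightarrow x$ is the open nucleus; for a filter $D$, $j_D=\bigvee_{d\in D}o_d$, the join taken in the frame of nuclei on $L$. $\operatorname{Fix}(j_D)$ is the frame of fixed points of $j_D$. A fitted sublocale is one that is an intersection of open sublocales. *)

(* Defs.v *)
From HB Require Import structures.
From mathcomp Require Import all_boot all_order.
From mathcomp Require Import boolp classical_sets.

Set Implicit Arguments.
Unset Strict Implicit.
Unset Printing Implicit Defensive.

Import Order.LTheory.
Local Open Scope classical_set_scope.
Local Open Scope order_scope.

Definition is_join d (L : porderType d) (I : Type) (a : I -> L) (u : L) : Prop :=
  (forall i, a i <= u) /\ (forall v, (forall i, a i <= v) -> u <= v).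

Lemma is_join_uniq d (L : porderType d) (I : Type) (a : I -> L) u v :
  is_join a u -> is_join a v -> u = v.
Proof. by move=> [au ul] [av vl]; apply/le_anti/andP; split; auto. Qed.

(* A family is a function out of an arbitrary small type, so an admissible
   presentation u = \/_i a_i is the datum (a, u). *)
Record distrForm := DistrForm {
  df_disp : Order.disp_t;
  df_sort :> tMeetSemilatticeType df_disp;
  adm : forall I : Type, (I -> df_sort) -> df_sort -> Prop;
  adm_join : forall (I : Type) (a : I -> df_sort) u, adm a u -> is_join a u;
  adm_unit : forall a : df_sort, adm (fun _ : unit => a) a;
  adm_reindex : forall (I J : Type) (f : J -> I) (a : I -> df_sort) u,
    bijective f -> adm a u -> adm (a \o f) u;
  adm_comp : forall (I : Type) (J : I -> Type) (a : I -> df_sort)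
      (b : forall i, J i -> df_sort) u,
    adm a u -> (forall i, adm (b i) (a i)) ->
    adm (fun p : {i : I & J i} => b (projT1 p) (projT2 p)) u;
  adm_meet : forall (I : Type) (a : I -> df_sort) u c,
    adm a u -> adm (fun i => a i `&` c) (u `&` c) }.

Record mor (L M : distrForm) := Mor {
  mor_fun :> L -> M;
  mor_top : mor_fun \top = \top;
  mor_meet : forall x y, mor_fun (x `&` y) = mor_fun x `&` mor_fun y;
  mor_adm : forall (I : Type) (a : I -> L) u,
    adm a u -> adm (mor_fun \o a) (mor_fun u) }.

Definition mor_iso (L M : distrForm) (f : mor L M) : Prop :=
  exists g : mor M L, cancel f g /\ cancel g f.

Definition null (L M : distrForm) (f : L -> M) : Prop := forall x, f x = \top.

Definition is_rel_kernel (K L M : distrForm) (k : mor K L) (u : mor L M) : Prop :=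
  null (u \o k) /\
  forall (H : distrForm) (h : mor H L), null (u \o h) ->
    exists! g : mor H K, k \o g = h.

Definition is_rel_cokernel (K L Q : distrForm) (q : mor L Q) (k : mor K L) : Prop :=
  null (q \o k) /\
  forall (H : distrForm) (h : mor L H), null (h \o k) ->
    exists! g : mor Q H, g \o q = h.

Definition short_exact (K L Q : distrForm) (k : mor K L) (q : mor L Q) : Prop :=
  is_rel_kernel k q /\ is_rel_cokernel q k.

Record ses (L : distrForm) := Ses {
  ses_ker : distrForm;
  ses_quo : distrForm;
  ses_inj : mor ses_ker L;
  ses_prj : mor L ses_quo;
  ses_exact : short_exact ses_inj ses_prj }.

Definition ses_iso (L : distrForm) (s t : ses L) : Prop :=
  (exists2 f : mor (ses_ker s) (ses_ker t),
     mor_iso f & ses_inj t \o f = ses_inj s) /\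
  (exists2 g : mor (ses_quo s) (ses_quo t),
     mor_iso g & g \o ses_prj s = ses_prj t).

(* An extensional presentation is an equivalence class of ses_iso. *)
Record ext_pres (L : distrForm) := ExtPres {
  ext_class : ses L -> Prop;
  ext_classP : exists s, ext_class = ses_iso s }.

Definition ext_of (L : distrForm) (s : ses L) : ext_pres L :=
  @ExtPres L (ses_iso s) (ex_intro _ s erefl).

Section Generated.
Context (d : Order.disp_t) (Q : tMeetSemilatticeType d).
Context (G : forall I : Type, (I -> Q) -> Q -> Prop).

Inductive generated : forall I : Type, (I -> Q) -> Q -> Prop :=
| gen_base (I : Type) (a : I -> Q) u : G a u -> generated a u
| gen_unit (a : Q) : generated (fun _ : unit => a) a
| gen_reindex (I J : Type) (f : J -> I) (a : I -> Q) u :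
    bijective f -> generated a u -> generated (a \o f) u
| gen_comp (I : Type) (J : I -> Type) (a : I -> Q) (b : forall i, J i -> Q) u :
    generated a u -> (forall i, generated (b i) (a i)) ->
    generated (fun p : {i : I & J i} => b (projT1 p) (projT2 p)) u
| gen_meet (I : Type) (a : I -> Q) u c :
    generated a u -> generated (fun i => a i `&` c) (u `&` c).

End Generated.

Section SubMeet.
Context (d : Order.disp_t) (L : tMeetSemilatticeType d).

Record submeet := SubMeet {
  submeet_set :> set L;
  submeet_top : submeet_set \top;
  submeet_meet : forall x y,
    submeet_set x -> submeet_set y -> submeet_set (x `&` y) }.

Record submeet_type (A : submeet) := SubMeetElt {
  submeet_val : L;
  submeet_valP : submeet_val \in submeet_set A }.

Context (A : submeet).

HB.instance Definition _ := [isSub of submeet_type A for @submeet_val A].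
HB.instance Definition _ := [Choice of submeet_type A by <:].
HB.instance Definition _ :=
  [SubChoice_isSubPOrder of submeet_type A by <: with d].

Lemma in_submeet (x : submeet_type A) : submeet_set A (val x).
Proof. exact/set_mem/(valP x). Qed.

Definition submeet_mk (x : L) (Ax : submeet_set A x) : submeet_type A :=
  SubMeetElt (mem_set Ax).

Definition submeet_I (x y : submeet_type A) : submeet_type A :=
  submeet_mk (submeet_meet (in_submeet x) (in_submeet y)).

Fact submeet_lexI (x y z : submeet_type A) :
  (x <= submeet_I y z) = (x <= y) && (x <= z).
Proof. by rewrite -!Order.le_val lexI. Qed.

Fact submeet_lex1 (x : submeet_type A) : x <= submeet_mk (submeet_top A).
Proof. by rewrite -Order.le_val lex1. Qed.

HB.instance Definition _ :=
  @Order.POrder_isMeetSemilattice.Build d (submeet_type A) submeet_I submeet_lexI.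
HB.instance Definition _ := @Order.hasTop.Build d (submeet_type A) _ submeet_lex1.

Lemma val_submeetI (x y : submeet_type A) : val (x `&` y) = val x `&` val y.
Proof. by []. Qed.

End SubMeet.

Record frame := Frame {
  fr_disp : Order.disp_t;
  fr_sort :> tMeetSemilatticeType fr_disp;
  fsup : forall I : Type, (I -> fr_sort) -> fr_sort;
  fsupP : forall (I : Type) (a : I -> fr_sort), is_join a (fsup a);
  fsup_meet : forall (I : Type) (a : I -> fr_sort) c,
    fsup a `&` c = fsup (fun i => a i `&` c) }.

Record frame_hom (L M : frame) := FrameHom {
  fh_fun :> L -> M;
  fh_top : fh_fun \top = \top;
  fh_meet : forall x y, fh_fun (x `&` y) = fh_fun x `&` fh_fun y;
  fh_sup : forall (I : Type) (a : I -> L), fh_fun (fsup a) = fsup (fh_fun \o a) }.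

Section Frame.
Context (L : frame).
Implicit Types (x y c : L) (I : Type).

Lemma is_joinE I (a : I -> L) u : is_join a u <-> u = fsup a.
Proof.
split=> [au|->]; [exact: is_join_uniq au (fsupP a)|exact: fsupP].
Qed.

Definition finf I (a : I -> L) : L :=
  fsup (fun y : {y : L | forall i, y <= a i} => sval y).

Lemma finf_lb I (a : I -> L) i : finf a <= a i.
Proof. by apply: (proj2 (fsupP _)) => -[y ya]. Qed.

Lemma finf_glb I (a : I -> L) y : (forall i, y <= a i) -> y <= finf a.
Proof.
by move=> ya; apply: (proj1 (fsupP (fun z : {z | forall i, z <= a i} => sval z))
  (exist _ y ya)).
Qed.

Definition heyt c x : L := fsup (fun y : {y : L | y `&` c <= x} => sval y).

Lemma le_heyt c x y : (y <= heyt c x) = (y `&` c <= x).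
Proof.
apply/idP/idP => [yh|yc].
  apply: (@le_trans _ _ (heyt c x `&` c)); first by rewrite leI2.
  by rewrite /heyt fsup_meet; apply: (proj2 (fsupP _)) => -[z zc].
exact: (proj1 (fsupP (fun z : {z | z `&` c <= x} => sval z)) (exist _ y yc)).
Qed.

Fact frame_adm_unit (a : L) : is_join (fun _ : unit => a) a.
Proof. by split=> [//|v /(_ tt)]. Qed.

Fact frame_adm_reindex (I J : Type) (f : J -> I) (a : I -> L) u :
  bijective f -> is_join a u -> is_join (a \o f) u.
Proof.
move=> [g fK gK] [au ul]; split=> [j|v av]; first exact: au.
by apply: ul => i; rewrite -(gK i); exact: av.
Qed.

Fact frame_adm_comp (I : Type) (J : I -> Type) (a : I -> L)
    (b : forall i, J i -> L) u :
  is_join a u -> (forall i, is_join (b i) (a i)) ->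
  is_join (fun p : {i : I & J i} => b (projT1 p) (projT2 p)) u.
Proof.
move=> [au ul] ba; split=> [[i j]|v bv] /=.
  by apply: le_trans (au i); exact: (proj1 (ba i)).
by apply: ul => i; apply: (proj2 (ba i)) => j; exact: (bv (existT _ i j)).
Qed.

Fact frame_adm_meet (I : Type) (a : I -> L) u c :
  is_join a u -> is_join (fun i => a i `&` c) (u `&` c).
Proof. by move=> /is_joinE ->; rewrite fsup_meet; exact: fsupP. Qed.

Definition frame_form : distrForm :=
  DistrForm (fun _ _ _ au => au) frame_adm_unit frame_adm_reindex
    frame_adm_comp frame_adm_meet.

Definition strongly_exact I (a : I -> L) : Prop :=
  forall (M : frame) (f : frame_hom L M),
    f (finf a) = fsup (fun y : {y : M | forall i, y <= f (a i)} => sval y).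

End Frame.

Record se_filter (L : frame) := SEFilter {
  sef_set :> set L;
  sef_top : sef_set \top;
  sef_up : forall x y, sef_set x -> x <= y -> sef_set y;
  sef_meet : forall x y, sef_set x -> sef_set y -> sef_set (x `&` y);
  sef_strong : forall (I : Type) (a : I -> L),
    (forall i, sef_set (a i)) -> strongly_exact a -> sef_set (finf a) }.

Section KernelTerm.
Context (L : distrForm) (D : submeet L).
Notation T := (submeet_type D).

Definition induced_adm (I : Type) (a : I -> T) (u : T) : Prop :=
  adm (val \o a) (val u).

Fact induced_join (I : Type) (a : I -> T) u : induced_adm a u -> is_join a u.
Proof.
move=> /adm_join [au ul]; split=> [i|v av]; rewrite -?Order.le_val; first exact: au.
by apply: ul => i /=; rewrite Order.le_val.
Qed.

Fact induced_unit (a : T) : induced_adm (fun _ : unit => a) a.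
Proof. exact: adm_unit (val a). Qed.

Fact induced_reindex (I J : Type) (f : J -> I) (a : I -> T) u :
  bijective f -> induced_adm a u -> induced_adm (a \o f) u.
Proof. exact: adm_reindex. Qed.

Fact induced_comp (I : Type) (J : I -> Type) (a : I -> T)
    (b : forall i, J i -> T) u :
  induced_adm a u -> (forall i, induced_adm (b i) (a i)) ->
  induced_adm (fun p : {i : I & J i} => b (projT1 p) (projT2 p)) u.
Proof.
by move=> au ba; exact: (adm_comp (b := fun i j => val (b i j)) au ba).
Qed.

Fact induced_meet (I : Type) (a : I -> T) u c :
  induced_adm a u -> induced_adm (fun i => a i `&` c) (u `&` c).
Proof. exact: adm_meet. Qed.

Definition induced_form : distrForm :=
  DistrForm induced_join induced_unit induced_reindex induced_comp induced_meet.

Definition induced_incl : mor induced_form L :=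
  @Mor induced_form L val erefl (fun _ _ => erefl) (fun _ _ _ au => au).

End KernelTerm.

Section Nuclei.
Context (L : frame).

Record nucleus := Nucleus {
  nuc :> L -> L;
  nuc_ge : forall x, x <= nuc x;
  nuc_idem : forall x, nuc (nuc x) = nuc x;
  nuc_meet : forall x y, nuc (x `&` y) = nuc x `&` nuc y }.

Definition nle (j k : nucleus) : Prop := forall x, j x <= k x.

Lemma nuc_homo (j : nucleus) x y : x <= y -> j x <= j y.
Proof. by move=> /meet_l xy; rewrite -xy nuc_meet leIr. Qed.

Lemma nuc_top (j : nucleus) : j \top = \top.
Proof. by apply/le_anti; rewrite lex1 nuc_ge. Qed.

Section Open.
Variable d : L.

Fact open_ge x : x <= heyt d x.
Proof. by rewrite le_heyt leIl. Qed.

Fact open_idem x : heyt d (heyt d x) = heyt d x.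
Proof.
apply/le_anti/andP; split; last exact: open_ge.
rewrite le_heyt; have: heyt d (heyt d x) `&` d <= heyt d x by rewrite -le_heyt.
by rewrite le_heyt -meetA meetxx.
Qed.

Fact open_meet x y : heyt d (x `&` y) = heyt d x `&` heyt d y.
Proof.
have hE z : heyt d z `&` d <= z by rewrite -le_heyt.
apply/le_anti; rewrite lexI !le_heyt lexI -andbA; apply/and4P; split.
- by apply: le_trans (hE _) _; exact: leIl.
- by apply: le_trans (hE _) _; exact: leIr.
- by apply: le_trans (hE x); rewrite leI2 ?leIl.
- by apply: le_trans (hE y); rewrite leI2 ?leIr.
Qed.

Definition open_nucleus : nucleus := Nucleus open_ge open_idem open_meet.

End Open.

(* Meets of nuclei are pointwise, so the join of a family of nuclei is the
   pointwise meet of its upper bounds; see nsup_ub and nsup_least. *)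
Section Join.
Variables (I : Type) (n : I -> nucleus).

Definition nsup_fun (x : L) : L :=
  finf (fun k : {k : nucleus | forall i, nle (n i) k} => sval k x).

Fact nsup_ge x : x <= nsup_fun x.
Proof. by apply: finf_glb => k; exact: nuc_ge. Qed.

Fact nsup_idem x : nsup_fun (nsup_fun x) = nsup_fun x.
Proof.
apply/le_anti/andP; split; last exact: nsup_ge.
apply: finf_glb => k; rewrite -nuc_idem.
by apply: le_trans (finf_lb _ k) _; apply: nuc_homo; exact: (finf_lb _ k).
Qed.

Fact nsup_meet x y : nsup_fun (x `&` y) = nsup_fun x `&` nsup_fun y.
Proof.
apply/le_anti; rewrite lexI -andbA; apply/and3P; split.
- apply: finf_glb => k; apply: le_trans (finf_lb _ k) _.
  by apply: nuc_homo; exact: leIl.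
- apply: finf_glb => k; apply: le_trans (finf_lb _ k) _.
  by apply: nuc_homo; exact: leIr.
- by apply: finf_glb => k; rewrite nuc_meet leI2 ?(finf_lb _ k).
Qed.

Definition nsup : nucleus := Nucleus nsup_ge nsup_idem nsup_meet.

Lemma nsup_ub i : nle (n i) nsup.
Proof. by move=> x; apply: finf_glb => -[k kn] /=; exact: kn. Qed.

Lemma nsup_least k : (forall i, nle (n i) k) -> nle nsup k.
Proof.
by move=> kn x; exact: (finf_lb (fun k : {k | forall i, nle (n i) k} => sval k x)
  (exist _ k kn)).
Qed.

End Join.

Definition filter_nucleus (D : set L) : nucleus :=
  nsup (fun d : {d : L | D d} => open_nucleus (sval d)).

Definition fix_set (j : nucleus) : set L := [set x | j x = x].

(* Binary meets and the top of Fix(j) are those of L. *)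
Definition fix_submeet (j : nucleus) : submeet L.
Proof.
apply: (@SubMeet _ _ (fix_set j)); first exact: nuc_top.
by move=> x y jx jy; rewrite /fix_set /= nuc_meet jx jy.
Defined.

Section Fix.
Variable j : nucleus.
Notation F := (submeet_type (fix_submeet j)).

Definition to_fix (x : L) : F := @submeet_mk _ _ (fix_submeet j) (j x) (nuc_idem j x).

Lemma fixP (x : F) : j (val x) = val x.
Proof. exact: (in_submeet x). Qed.

Lemma to_fixK : cancel (val : F -> L) to_fix.
Proof. by move=> x; apply: val_inj; exact: fixP. Qed.

Lemma to_fix_le (x : L) (v : F) : (to_fix x <= v) = (x <= val v).
Proof.
rewrite -Order.le_val /=; apply/idP/idP => [|xv]; first exact/le_trans/nuc_ge.
by rewrite -(fixP v); exact: nuc_homo.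
Qed.

Lemma to_fix_top : to_fix \top = \top.
Proof. by apply: val_inj; exact: nuc_top. Qed.

Lemma to_fix_meet x y : to_fix (x `&` y) = to_fix x `&` to_fix y.
Proof. by apply: val_inj; exact: nuc_meet. Qed.

Lemma to_fix_join (I : Type) (a : I -> L) u :
  is_join a u -> is_join (to_fix \o a) (to_fix u).
Proof.
move=> [au ul]; split=> [i|v av]; first by rewrite -Order.le_val nuc_homo.
by rewrite to_fix_le; apply: ul => i; rewrite -to_fix_le; exact: av.
Qed.

Definition fix_image (I : Type) (b : I -> F) (v : F) : Prop :=
  exists (a : I -> L) (u : L),
    [/\ is_join a u, b = to_fix \o a & v = to_fix u].

Definition fix_adm := generated fix_image.

Lemma fix_image_join (I : Type) (b : I -> F) v : fix_image b v <-> is_join b v.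
Proof.
split=> [[a [u [au -> ->]]]|bv]; first exact: to_fix_join.
have bE : b = to_fix \o (val \o b) by apply/funext => i /=; rewrite to_fixK.
exists (val \o b), (fsup (val \o b)); split=> //; first exact: fsupP.
apply: is_join_uniq bv _; rewrite [X in is_join X]bE.
exact/to_fix_join/fsupP.
Qed.

Fact fix_join (I : Type) (b : I -> F) v : fix_adm b v -> is_join b v.
Proof.
elim=> {I b v} [I b v /fix_image_join//|a|I J f a u [g fK gK] _ [au ul]|
                I J a b u _ [au ul] _ ba|I a u c _ /fix_image_join].
- by split=> [//|v /(_ tt)].
- split=> [i|v av]; first exact: au.
  by apply: ul => i; rewrite -(gK i); exact: av.
- split=> [[i k]|v bv] /=; first by apply: le_trans (au i); exact: (proj1 (ba i)).
  by apply: ul => i; apply: (proj2 (ba i)) => k; exact: (bv (existT _ i k)).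
- move=> [a' [u' [au -> ->]]]; apply/fix_image_join.
  exists (fun i => a' i `&` val c), (u' `&` val c); split.
  + exact: frame_adm_meet.
  + by apply/funext => i /=; rewrite to_fix_meet to_fixK.
  + by rewrite to_fix_meet to_fixK.
Qed.

Definition fix_form : distrForm :=
  DistrForm fix_join (@gen_unit _ _ _) (@gen_reindex _ _ _) (@gen_comp _ _ _)
    (@gen_meet _ _ _).

(* So fix_form is Fix(j), a frame, with all of its joins admissible. *)
Lemma fix_admE (I : Type) (b : I -> F) v : fix_adm b v <-> is_join b v.
Proof.
by split=> [|bv]; [exact: fix_join | apply/gen_base/fix_image_join].
Qed.

Definition fix_quo : mor (frame_form L) fix_form.
Proof.
apply: (@Mor (frame_form L) fix_form to_fix to_fix_top to_fix_meet).
by move=> I a u au; apply: gen_base; exists a, u.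
Defined.

End Fix.

Definition is_sublocale (S : set L) : Prop :=
  (forall (I : Type) (a : I -> L), (forall i, S (a i)) -> S (finf a)) /\
  (forall c x, S x -> S (heyt c x)).

Definition open_sublocale (c : L) : set L := fix_set (open_nucleus c).

Record fitted_sublocale := Fitted {
  fitted_set :> set L;
  fitted_sublocaleP : is_sublocale fitted_set;
  fittedP : exists (I : Type) (c : I -> L),
    fitted_set = \bigcap_(i in [set: I]) open_sublocale (c i) }.

End Nuclei.

Definition filter_submeet (L : frame) (D : se_filter L) : submeet (frame_form L) :=
  SubMeet (sef_top D) (@sef_meet L D).

Definition filter_incl (L : frame) (D : se_filter L) :
    mor (induced_form (filter_submeet D)) (frame_form L) :=
  induced_incl (filter_submeet D).

Definition filter_quo (L : frame) (D : se_filter L) :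
    mor (frame_form L) (fix_form (filter_nucleus D)) :=
  fix_quo (filter_nucleus D).

(* Main.v *)
Require Import Defs.
From mathcomp Require Import all_boot all_order.
From mathcomp Require Import boolp classical_sets.

Set Implicit Arguments.
Unset Strict Implicit.
Unset Printing Implicit Defensive.

Import Order.LTheory.
Local Open Scope classical_set_scope.
Local Open Scope order_scope.

(** Both correspondences pass through nuclei.  To a nucleus [j] belong its
    fixed points and the filter [[set x | j x = \top]]; the latter is strongly
    exact because the quotient map onto [Fix(j)] is a frame homomorphism, hence
    preserves strongly exact meets.  Since [o_d <= j] if and only if
    [j d = \top] ([open_nle]), the nucleus [j_D] is the least one that sends
    [D] to the top.

    The heart of the proof is that a strongly exact filter is recovered from
    its nucleus: [j_D x = \top] implies that [x] is in [D]
    ([filter_nucleus_topE]).  One shows that [x] is the meet of the members of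
    [D] above it and that this meet is strongly exact, the latter by the
    criterion that a meet is strongly exact when the join of the corresponding
    open nuclei sends it to the top ([open_strongly_exact]).

    This makes [D] the full preimage of the top under [j_D], hence its kernel.
    It is also why [j_D] is a cokernel of [D]: a morphism [h] out of [L]
    preserves all joins, so each [x] has a largest element [k x] with
    [h (k x) = h x], and [k] is a nucleus even though the codomain of [h] need
    not be a frame; if [h] kills [D] then [j_D <= k], so [h] factors through
    [Fix(j_D)].  The same nucleus [k], for the quotient map of a given short
    exact sequence, shows that its kernel is a strongly exact filter, and
    uniqueness of kernels and cokernels identifies the sequence with the one
    built from that filter.

    For fitted sublocales, joins of nuclei correspond to intersections of sets
    of fixed points ([fix_nsup]), so the sublocales [Fix(j_D)] are intersections
    of open ones, every intersection of open ones is [Fix(j)] for a join [j] of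
    open nuclei, and such a [j] equals [j_D] for the filter [D] of elements that
    it sends to the top. *)

Lemma inj_surj_bij (A B : Type) (f : A -> B) :
  injective f -> (forall y, exists x, f x = y) -> bijective f.
Proof.
by move=> finj /choice[g fgK]; exists g => // x; apply: finj; rewrite fgK.
Qed.

(** * Morphisms and extensional presentations *)

Lemma mor_eq (L M : distrForm) (f g : mor L M) : mor_fun f = mor_fun g -> f = g.
Proof.
case: f g => [f f1 fI fa] [g g1 gI ga] /= fg; case: g / fg g1 gI ga => *.
by congr Mor; exact: Prop_irrelevance.
Qed.

Lemma mor_homo (L M : distrForm) (f : mor L M) x y : x <= y -> f x <= f y.
Proof. by move=> /meet_l xy; rewrite -xy mor_meet leIr. Qed.

Definition mor_id (L : distrForm) : mor L L :=
  @Mor L L id erefl (fun _ _ => erefl) (fun _ _ _ au => au).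

Definition mor_comp (L M N : distrForm) (g : mor M N) (f : mor L M) : mor L N.
Proof.
apply: (@Mor L N (g \o f)) => [|x y|I a u au] /=; first by rewrite !mor_top.
  by rewrite !mor_meet.
exact: (mor_adm g (mor_adm f au)).
Defined.

Lemma mor_iso_id (L : distrForm) : mor_iso (mor_id L).
Proof. by exists (mor_id L). Qed.

Lemma mor_iso_comp (L M N : distrForm) (g : mor M N) (f : mor L M) :
  mor_iso g -> mor_iso f -> mor_iso (mor_comp g f).
Proof.
move=> [g' [gK g'K]] [f' [fK f'K]]; exists (mor_comp f' g').
by split=> x /=; rewrite ?gK ?fK ?f'K ?g'K.
Qed.

Section Uniqueness.
Context (L : distrForm).

Lemma rel_kernel_iso (K K' M : distrForm) (k : mor K L) (k' : mor K' L)
    (u : mor L M) :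
  is_rel_kernel k u -> is_rel_kernel k' u ->
  exists2 f : mor K K', mor_iso f & k' \o f = k.
Proof.
move=> [uk kU] [uk' k'U].
have [f [kf _]] := k'U _ _ uk; have [g [kg _]] := kU _ _ uk'.
exists f => //; exists g; split=> x.
- have [i [_ iU]] := kU _ _ uk.
  have gf : k \o mor_comp g f = k by rewrite [RHS](esym kf) -kg.
  have id_i : k \o mor_id K = k by [].
  exact: (congr1 (fun h : mor K K => h x) (etrans (esym (iU _ gf)) (iU _ id_i))).
- have [i [_ iU]] := k'U _ _ uk'.
  have fg : k' \o mor_comp f g = k' by rewrite [RHS](esym kg) -kf.
  have id_i : k' \o mor_id K' = k' by [].
  exact: (congr1 (fun h : mor K' K' => h x) (etrans (esym (iU _ fg)) (iU _ id_i))).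
Qed.

(** The universal property of a cokernel depends on [k] only through the
    morphisms out of [L] that kill it, so [k] and [k'] may have different
    domains. *)
Lemma rel_cokernel_iso (K K' Q Q' : distrForm) (k : mor K L) (k' : mor K' L)
    (q : mor L Q) (q' : mor L Q') :
  (forall (H : distrForm) (h : mor L H), null (h \o k) <-> null (h \o k')) ->
  is_rel_cokernel q k -> is_rel_cokernel q' k' ->
  exists2 f : mor Q Q', mor_iso f & f \o q = q'.
Proof.
move=> kk' [qk qU] [qk' q'U].
have [f [fq _]] := qU _ _ (proj2 (kk' _ _) qk').
have [g [gq _]] := q'U _ _ (proj1 (kk' _ _) qk).
exists f => //; exists g; split=> x.
- have [i [_ iU]] := qU _ _ qk.
  have gf : mor_comp g f \o q = q by rewrite [RHS](esym gq) -fq.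
  have id_i : mor_id Q \o q = q by [].
  exact: (congr1 (fun h : mor Q Q => h x) (etrans (esym (iU _ gf)) (iU _ id_i))).
- have [i [_ iU]] := q'U _ _ qk'.
  have fg : mor_comp f g \o q' = q' by rewrite [RHS](esym fq) -gq.
  have id_i : mor_id Q' \o q' = q' by [].
  exact: (congr1 (fun h : mor Q' Q' => h x) (etrans (esym (iU _ fg)) (iU _ id_i))).
Qed.

Lemma ses_iso_refl (s : ses L) : ses_iso s s.
Proof.
by split; [exists (mor_id _)|exists (mor_id _)] => //; exact: mor_iso_id.
Qed.

Lemma ses_iso_sym (s t : ses L) : ses_iso s t -> ses_iso t s.
Proof.
move=> [[f [f' [fK f'K]] ft] [g [g' [gK g'K]] gs]]; split.
- exists f'; first by exists f.
  by apply/funext => x /=; rewrite -ft /= f'K.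
- exists g'; first by exists g.
  by apply/funext => x /=; rewrite -gs /= gK.
Qed.

Lemma ses_iso_trans (s t r : ses L) : ses_iso s t -> ses_iso t r -> ses_iso s r.
Proof.
move=> [[f fi ft] [g gi gt]] [[f' fi' ft'] [g' gi' gt']]; split.
- exists (mor_comp f' f); first exact: mor_iso_comp.
  by rewrite -ft -ft'.
- exists (mor_comp g' g); first exact: mor_iso_comp.
  by rewrite -gt' -gt.
Qed.

Lemma ext_ofE (s t : ses L) : ext_of s = ext_of t <-> ses_iso s t.
Proof.
split=> [/(congr1 (@ext_class L)) /= ->|st]; first exact: ses_iso_refl.
suff E : ses_iso s = ses_iso t.
  rewrite /ext_of; move: (ex_intro _ s _) (ex_intro _ t _); rewrite E => p q.
  by congr ExtPres; exact: Prop_irrelevance.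
apply/funext => r; apply/propext; split; last exact: ses_iso_trans.
exact/ses_iso_trans/ses_iso_sym.
Qed.

Lemma ext_of_surj (e : ext_pres L) : exists s, e = ext_of s.
Proof.
case: e => P Pex; have [s Ps] := Pex; exists s.
by move: Pex; rewrite Ps => Pex; congr ExtPres; exact: Prop_irrelevance.
Qed.

Lemma ses_iso_range (s t : ses L) :
  ses_iso s t -> range (ses_inj s) = range (ses_inj t).
Proof.
move=> [[f [g [_ gK]] ft] _]; apply/seteqP; split=> [_ [x _ <-]|_ [x _ <-]].
  by exists (f x) => //; rewrite -ft.
by exists (g x) => //; rewrite -ft /= gK.
Qed.

End Uniqueness.

(** * Nuclei of a frame *)

Section FrameNuclei.
Context (L : frame).
Implicit Types (j k : nucleus L) (x y z : L).

Lemma top_le x : (\top <= x) = (x == \top).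
Proof. by rewrite [in RHS]eq_le lex1. Qed.

Lemma heyt_top c x : heyt c x = \top <-> c <= x.
Proof.
rewrite -[c in c <= x]meet1x -le_heyt top_le; split=> [->//|/eqP//].
Qed.

(** One direction is modus ponens under the nucleus: [d `&` (d => x) <= x] and
    [k d = \top] give [d => x <= k x].  Hence above the open nuclei of a set
    are exactly the nuclei that send this set to the top. *)
Lemma open_nle (d : L) k : nle (open_nucleus d) k <-> k d = \top.
Proof.
split=> [/(_ d) dk|kd x].
  apply/eqP; rewrite -top_le; apply: le_trans dk => /=.
  by rewrite top_le; apply/eqP/heyt_top.
rewrite /=; apply: le_trans (nuc_ge k _) _.
rewrite -[k (heyt d x)]meetx1 -kd -nuc_meet; apply: nuc_homo.
by rewrite -le_heyt.
Qed.

Lemma filter_nucleus_nle (D : set L) k :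
  nle (filter_nucleus D) k <-> forall d, D d -> k d = \top.
Proof.
split=> [Dk d Dd|kD].
  apply/open_nle => x; apply: le_trans (Dk x).
  exact: (nsup_ub (fun d : {d : L | D d} => open_nucleus (sval d)) (exist _ d Dd)).
by apply: nsup_least => -[d Dd]; apply/open_nle/kD.
Qed.

Lemma filter_nucleus_top (D : set L) d : D d -> filter_nucleus D d = \top.
Proof. by move: d; apply/filter_nucleus_nle => x. Qed.

Fact heyt2_ge x z : z <= heyt (heyt z x) x.
Proof. by rewrite le_heyt meetC -le_heyt. Qed.

Lemma heyt_anti x y z : y <= z -> heyt z x <= heyt y x.
Proof.
move=> yz; rewrite le_heyt; apply: (@le_trans _ _ (heyt z x `&` z)).
  by rewrite leI2.
by rewrite -le_heyt.
Qed.

Fact heyt2_idem x z :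
  heyt (heyt (heyt (heyt z x) x) x) x = heyt (heyt z x) x.
Proof.
apply/le_anti; rewrite heyt2_ge andbT.
exact/heyt_anti/heyt2_ge.
Qed.

Fact heyt2_meet x y z :
  heyt (heyt (y `&` z) x) x = heyt (heyt y x) x `&` heyt (heyt z x) x.
Proof.
apply/le_anti; rewrite lexI -andbA; apply/and3P; split.
- by apply/heyt_anti/heyt_anti/leIl.
- by apply/heyt_anti/heyt_anti/leIr.
have mp a b : heyt a b `&` a <= b by rewrite -le_heyt.
set A := heyt (heyt y x) x; set B := heyt (heyt z x) x.
set c := heyt (y `&` z) x.
(* Below c, the element y lies under z => x, so B `&` c `&` y lies below x;
   hence B `&` c lies under y => x, and its meet with A lies below x. *)
have Bcy : B `&` c `&` y <= x.
  apply: (@le_trans _ _ (B `&` heyt z x)); last exact: mp.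
  rewrite -meetA leI2 // le_heyt -meetA; exact: mp.
rewrite le_heyt -meetA; apply: (@le_trans _ _ (A `&` heyt y x)); last exact: mp.
by rewrite leI2 // le_heyt.
Qed.

(** The double-negation nucleus relative to [x]: the largest nucleus that
    fixes [x]. *)
Definition point_nucleus x : nucleus L :=
  Nucleus (heyt2_ge x) (heyt2_idem x) (heyt2_meet x).

Lemma point_nucleus_fix x : point_nucleus x x = x.
Proof.
apply/le_anti; rewrite nuc_ge andbT /=.
have -> : heyt x x = \top by apply/heyt_top.
by rewrite -[heyt _ _]meetx1 -le_heyt.
Qed.

Lemma point_nucleus_max j x : j x = x -> nle j (point_nucleus x).
Proof.
move=> jx z /=; rewrite le_heyt -[leRHS]jx.
apply: (@le_trans _ _ (j (z `&` heyt z x))).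
  by rewrite nuc_meet leI2 // nuc_ge.
by apply: nuc_homo; rewrite meetC -le_heyt.
Qed.

(** Joins of nuclei are intersections of sublocales.  If every [n i] fixes [x],
    then [point_nucleus x] is one of the upper bounds over which the join is
    computed, and it keeps [x] fixed. *)
Lemma fix_nsup (I : Type) (n : I -> nucleus L) :
  fix_set (nsup n) = \bigcap_(i in [set: I]) fix_set (n i).
Proof.
apply/seteqP; split=> x /= => [nx i _|nx].
  by apply/le_anti; rewrite nuc_ge andbT -[leRHS]nx; exact: nsup_ub.
apply/le_anti; rewrite nuc_ge andbT -[leRHS]point_nucleus_fix.
by apply: nsup_least => i; apply/point_nucleus_max/nx.
Qed.

Lemma nle_fix j k : nle j k <-> fix_set k `<=` fix_set j.
Proof.
split=> [jk x kx|kj x].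
  by apply/le_anti; rewrite nuc_ge andbT -[leRHS]kx; exact: jk.
have /kj <- : fix_set k (k x) by exact: nuc_idem.
exact/nuc_homo/nuc_ge.
Qed.

Lemma fix_set_sublocale j : is_sublocale (fix_set j).
Proof.
split=> [I a ja|c x jx].
  apply/le_anti; rewrite nuc_ge andbT; apply: finf_glb => i.
  by rewrite -[leRHS]ja; exact/nuc_homo/finf_lb.
apply/le_anti; rewrite nuc_ge andbT le_heyt -[leRHS]jx.
apply: (@le_trans _ _ (j (heyt c x `&` c))).
  by rewrite nuc_meet leI2 // nuc_ge.
by apply: nuc_homo; rewrite -le_heyt.
Qed.

End FrameNuclei.

(** * Frame quotients and kernel nuclei *)

Section FrameQuotients.
Context (L : frame).
Implicit Types x y w : L.

Section FixFrame.
Variable j : nucleus L.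
Notation F := (submeet_type (fix_submeet j)).

Definition fix_sup (I : Type) (b : I -> F) : F := to_fix j (fsup (val \o b)).

Fact fix_supP (I : Type) (b : I -> F) : is_join b (fix_sup b).
Proof.
have {1}-> : b = to_fix j \o (val \o b) by apply/funext => i /=; rewrite to_fixK.
exact/to_fix_join/fsupP.
Qed.

Fact fix_sup_meet (I : Type) (b : I -> F) c :
  fix_sup b `&` c = fix_sup (fun i => b i `&` c).
Proof. by rewrite -[c in LHS]to_fixK -to_fix_meet fsup_meet. Qed.

Definition fix_frame : frame := Frame fix_supP fix_sup_meet.

Fact to_fix_sup (I : Type) (a : I -> L) :
  to_fix j (fsup a) = @fsup fix_frame I (to_fix j \o a).
Proof. exact/(@is_joinE fix_frame)/to_fix_join/fsupP. Qed.

Definition fix_hom : frame_hom L fix_frame :=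
  @FrameHom L fix_frame (to_fix j) (to_fix_top j) (to_fix_meet j) to_fix_sup.

End FixFrame.

Section KernelNucleus.
Context (H : distrForm) (h : mor (frame_form L) H).

Definition kernel_closure x : L :=
  fsup (fun w : {w : L | h w <= h x} => sval w).

Lemma le_kernel_closure x w : h w <= h x -> w <= kernel_closure x.
Proof.
move=> wx; exact: (proj1 (fsupP (fun w : {w : L | h w <= h x} => sval w))
  (exist _ w wx)).
Qed.

(** Every join of [L] is admissible, so [h] carries the join that defines
    [kernel_closure x] to a join of elements below [h x], although [H] itself
    may lack most joins. *)
Lemma mor_kernel_closure x : h (kernel_closure x) = h x.
Proof.
apply/le_anti/andP; split; last exact/mor_homo/le_kernel_closure.
have := @mor_adm _ _ h _ _ _ (fsupP (fun w : {w : L | h w <= h x} => sval w)).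
by move=> /adm_join [_]; apply=> -[w wx].
Qed.

Fact kernel_closure_ge x : x <= kernel_closure x.
Proof. exact: le_kernel_closure. Qed.

Fact kernel_closure_idem x :
  kernel_closure (kernel_closure x) = kernel_closure x.
Proof.
apply/le_anti; rewrite kernel_closure_ge andbT.
by apply: le_kernel_closure; rewrite !mor_kernel_closure.
Qed.

Fact kernel_closure_meet x y :
  kernel_closure (x `&` y) = kernel_closure x `&` kernel_closure y.
Proof.
have mono a b : a <= b -> kernel_closure a <= kernel_closure b.
  move=> ab; apply: le_kernel_closure; rewrite mor_kernel_closure.
  exact: mor_homo.
apply/le_anti; rewrite lexI !mono ?leIl ?leIr //=.
apply: le_kernel_closure.
have hI a b : h (a `&` b) = h a `&` h b := @mor_meet _ _ h a b.
by rewrite !hI !mor_kernel_closure.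
Qed.

Definition kernel_nucleus : nucleus L :=
  Nucleus kernel_closure_ge kernel_closure_idem kernel_closure_meet.

Lemma kernel_nucleus_top x : kernel_nucleus x = \top <-> h x = \top.
Proof.
split=> [kx|hx]; first by rewrite -mor_kernel_closure [kernel_closure x]kx mor_top.
by apply/eqP; rewrite -top_le; apply: le_kernel_closure; rewrite hx lex1.
Qed.

(** The nucleus of [h] lies above all [o_d] with [h d = \top], hence above
    their join, and [h] does not see its own nucleus. *)
Lemma mor_filter_nucleus (D : set L) x :
  (forall d, D d -> h d = \top) -> h (filter_nucleus D x) = h x.
Proof.
move=> hD; apply/le_anti/andP; split; last exact/mor_homo/nuc_ge.
rewrite -[leRHS]mor_kernel_closure; apply: mor_homo.
have : nle (filter_nucleus D) kernel_nucleus.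
  by apply/filter_nucleus_nle => d /hD/kernel_nucleus_top.
exact.
Qed.

End KernelNucleus.

(** * Strongly exact filters *)

Lemma se_filter_eq (D E : se_filter L) : sef_set D = sef_set E -> D = E.
Proof.
case: D E => [D D1 DU DI Ds] [E E1 EU EI Es] /= DE.
case: E / DE E1 EU EI Es => *; congr SEFilter; exact: Prop_irrelevance.
Qed.

Definition frame_hom_mor (M : frame) (f : frame_hom L M) :
  mor (frame_form L) (frame_form M).
Proof.
apply: (@Mor (frame_form L) (frame_form M) f (fh_top f) (fh_meet f)).
by move=> I a u /is_joinE ->; rewrite fh_sup; exact: fsupP.
Defined.

(** Open parts of the codomain detect the meet.  For a frame homomorphism [f]
    and [m] below all [f (a i)], localizing [f] at the open part [m] of its
    codomain gives a morphism that sends all [a i] to the top.  Its kernel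
    nucleus then lies above the join of the [o_(a i)], so the morphism sends
    [finf a] to the top as well, which says that [m <= f (finf a)]. *)
Lemma open_strongly_exact (I : Type) (a : I -> L) :
  nsup (fun i => open_nucleus (a i)) (finf a) = \top -> strongly_exact a.
Proof.
move=> ja M f.
have fmono x y : x <= y -> f x <= f y by apply: (mor_homo (frame_hom_mor f)).
rewrite -[RHS]/(finf (f \o a)); apply/le_anti/andP; split.
  by apply: finf_glb => i; exact/fmono/finf_lb.
set m := finf _; pose h := mor_comp (fix_quo (open_nucleus m)) (frame_hom_mor f).
have hE x : h x = \top <-> m <= f x.
  split=> [hx|/heyt_top mx]; last exact: val_inj.
  by apply/heyt_top; exact: (congr1 val hx).
apply/hE/kernel_nucleus_top/eqP; rewrite -top_le -ja.
apply: nsup_least => i; apply/open_nle/kernel_nucleus_top/hE.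
exact: (finf_lb (f \o a)).
Qed.

End FrameQuotients.

(** Strongly exact meets are preserved by the quotient map onto [Fix(j)], and a
    meet of copies of the top is the top. *)
Definition nucleus_filter (L : frame) (j : nucleus L) : se_filter L.
Proof.
apply: (@SEFilter L [set x | j x = \top]) => /= [|x y jx xy|x y jx jy|I a ja sa].
- exact: nuc_top.
- by apply/eqP; rewrite -top_le -jx; exact: nuc_homo.
- by rewrite nuc_meet jx jy meetxx.
have tF i : (\top : fix_frame j) <= fix_hom j (a i).
  by rewrite -Order.le_val /= ja lex1.
apply/eqP; rewrite -top_le.
have := proj1 (fsupP (fun y : {y : fix_frame j | forall i, y <= fix_hom j (a i)} =>
  sval y)) (exist _ \top tF).
by rewrite -sa -Order.le_val.
Defined.

(** Let [j_D x = \top], let [y] be the meet of the members of [D] above [x], and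
    let [k] be the join of the open nuclei of these members.  First,
    [k x = \top]: for [d] in [D] the element [e = (d => k x) => k x] is a member
    of [D] above [x], so [k e = \top], which forces [d => k x <= k x]; hence the
    largest nucleus that fixes [k x] sends [D] to the top, so it lies above
    [j_D] and sends [x] to the top, while its value at [x] is at most [k x].
    Now [x <= y] gives [k y = \top], so the meet [y] is strongly exact and lies
    in [D].  Finally [k] lies below [o_y], whence [\top = k x <= (y => x)], that
    is, [y <= x]. *)
Lemma filter_nucleus_topE (L : frame) (D : se_filter L) (x : L) :
  filter_nucleus D x = \top <-> sef_set D x.
Proof.
split=> [Dx|]; last exact: filter_nucleus_top.
pose F := {d : L | sef_set D d /\ x <= d}.
pose k := nsup (fun d : F => open_nucleus (sval d)).
pose y := finf (fun d : F => sval d).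
have kF d : sef_set D d -> x <= d -> k d = \top.
  move=> Dd xd; apply/open_nle.
  exact: (nsup_ub (fun d : F => open_nucleus (sval d)) (exist _ d (conj Dd xd))).
have kx : k x = \top.
  have : nle (filter_nucleus D) (point_nucleus (k x)).
    apply/filter_nucleus_nle => d Dd; apply/heyt_top; set w := heyt d (k x).
    have ke : k (heyt w (k x)) = \top.
      apply: kF; first by apply: sef_up Dd _; exact: heyt2_ge.
      by apply: le_trans (nuc_ge k x) _; exact: open_ge.
    apply: le_trans (nuc_ge k w) _.
    rewrite -[k w]meetx1 -ke -nuc_meet -[k x]nuc_idem; apply: nuc_homo.
    by rewrite nuc_idem meetC -le_heyt.
  move=> /(_ x); rewrite Dx top_le => /eqP px.
  apply/eqP; rewrite -top_le -px -[leRHS]point_nucleus_fix.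
  exact/nuc_homo/nuc_ge.
have xy : x <= y by apply: finf_glb => -[d []].
have Dy : sef_set D y.
  apply: sef_strong => [[d []]//|]; apply: open_strongly_exact.
  by apply/eqP; rewrite -top_le -kx; exact: nuc_homo.
apply: (sef_up Dy); apply/heyt_top/eqP; rewrite -top_le -kx.
apply: (@nsup_least _ _ _ (open_nucleus y)) => d; apply/open_nle/heyt_top.
exact: (finf_lb (fun d : F => sval d)).
Qed.

(** * The short exact sequence of a strongly exact filter *)

(** A morphism that [q] kills lands in [D], and it is admissible as a map into
    [D] because the inclusion reflects the induced distributivity. *)
Lemma induced_kernel (L M : distrForm) (D : submeet L) (q : mor L M) :
  (forall x, submeet_set D x <-> q x = \top) -> is_rel_kernel (induced_incl D) q.
Proof.
move=> Dq; split=> [x|H h hq]; first exact/Dq/in_submeet.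
have Dh x : submeet_set D (h x) by apply/Dq/hq.
pose g x : induced_form D := submeet_mk (Dh x).
have g1 : g \top = \top by apply: val_inj; exact: mor_top.
have gI x y : g (x `&` y) = g x `&` g y by apply: val_inj; exact: mor_meet.
exists (@Mor H (induced_form D) g g1 gI (@mor_adm _ _ h)); split=> // g' g'h.
apply/mor_eq/funext => x; apply: val_inj; exact: (congr1 (fun f => f x) (esym g'h)).
Qed.

(** A morphism [h] that kills [D] is unchanged by [j_D], so it is determined by
    its values on fixed points; joins in [Fix(j_D)] are [j_D]-images of joins in
    [L], so its restriction is again a morphism. *)
Lemma filter_cokernel (L : frame) (D : se_filter L) :
  is_rel_cokernel (filter_quo D) (filter_incl D).
Proof.
split=> [x|H h hD]; first exact/val_inj/filter_nucleus_top/in_submeet.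
set j := filter_nucleus D.
have hj x : h (j x) = h x.
  apply: mor_filter_nucleus => d Dd.
  exact: (hD (submeet_mk (A := filter_submeet D) Dd)).
pose g (v : fix_form j) : H := h (val v).
have g1 : g \top = \top by exact: (mor_top h).
have gI v w : g (v `&` w) = g v `&` g w by exact: (mor_meet h).
have ga I (b : I -> fix_form j) v : adm b v -> adm (g \o b) (g v).
  move=> /fix_join bv.
  have -> : v = fix_sup b by exact: is_join_uniq bv (fix_supP b).
  rewrite /g /= hj; apply: (@mor_adm _ _ h); exact: fsupP.
exists (Mor g1 gI ga); split=> [|g' g'h]; first by apply/funext => x; exact: hj.
apply/mor_eq/funext => v; rewrite -[v in RHS]to_fixK.
exact: (congr1 (fun f => f (val v)) (esym g'h)).
Qed.

Lemma filter_short_exact (L : frame) (D : se_filter L) :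
  short_exact (filter_incl D) (filter_quo D).
Proof.
split; last exact: filter_cokernel.
apply: induced_kernel => x; split=> [/filter_nucleus_topE Dx|qx].
  exact: val_inj.
by apply/filter_nucleus_topE; exact: (congr1 val qx).
Qed.

Lemma range_filter_incl (L : frame) (D : se_filter L) :
  range (filter_incl D) = sef_set D.
Proof.
apply/seteqP; split=> [_ [x _ <-]|x Dx]; first exact: (in_submeet x).
by exists (submeet_mk (A := filter_submeet D) Dx).
Qed.

Lemma ext_of_range (L : frame) (s : ses (frame_form L)) (D : se_filter L) :
  ext_of s = ext_of (Ses (filter_short_exact D)) -> range (ses_inj s) = sef_set D.
Proof. by move=> /ext_ofE/ses_iso_range ->; exact: range_filter_incl. Qed.

(** The filter is the preimage of the top under the quotient map [q], presented
    as the filter of the kernel nucleus of [q].  Its inclusion is a kernel of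
    [q], hence isomorphic to the given kernel; so the two kernels are killed by
    the same morphisms, and their cokernels are isomorphic as well. *)
Lemma ext_of_filter (L : frame) (s : ses (frame_form L)) :
  exists D, ext_of (Ses (filter_short_exact D)) = ext_of s.
Proof.
case: s => K Q k q kq; have [kker qcok] := kq.
pose D := nucleus_filter (kernel_nucleus q).
exists D; apply/esym/ext_ofE.
have Dker : is_rel_kernel (filter_incl D) q.
  by apply: induced_kernel => x; exact: kernel_nucleus_top.
have [f fi fk] := rel_kernel_iso kker Dker.
split; first by exists f.
apply: rel_cokernel_iso qcok (filter_cokernel D) => H h.
rewrite -fk; case: fi => g [_ gK]; split=> [hk x|hk x]; last exact: hk.
by rewrite /= -[x]gK; exact: hk.
Qed.

Lemma ext_of_bij (L : frame) :
  bijective (fun D : se_filter L => ext_of (Ses (filter_short_exact D))).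
Proof.
apply: inj_surj_bij => [D E /ext_of_range|e].
  by rewrite range_filter_incl; exact: se_filter_eq.
have [s ->] := ext_of_surj e; exact: ext_of_filter.
Qed.

(** * Fitted sublocales *)

Lemma fitted_eq (L : frame) (S T : fitted_sublocale L) :
  fitted_set S = fitted_set T -> S = T.
Proof.
case: S T => [S S1 S2] [T T1 T2] /= ST; case: T / ST T1 T2 => *.
by congr Fitted; exact: Prop_irrelevance.
Qed.

Lemma filter_fitted (L : frame) (D : se_filter L) :
  is_sublocale (fix_set (filter_nucleus (sef_set D))) /\
  exists (I : Type) (c : I -> L),
    fix_set (filter_nucleus (sef_set D)) =
    \bigcap_(i in [set: I]) open_sublocale (c i).
Proof.
split; first exact: fix_set_sublocale.
by exists {d : L | sef_set D d}, (fun d => sval d); exact: fix_nsup.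
Qed.

(** Injectivity: [Fix(j_D)] determines [j_D], hence the preimage [D] of the top.
    Surjectivity: if [j] is the join of the [o_(c i)] and [D] is the filter of
    elements that [j] sends to the top, then [j_D <= j] by minimality, and
    [j <= j_D] because all [c i] belong to [D]. *)
Lemma fitted_bij (L : frame) :
  bijective (fun D : se_filter L =>
    Fitted (proj1 (filter_fitted D)) (proj2 (filter_fitted D))).
Proof.
apply: inj_surj_bij => [D E /(congr1 (@fitted_set L)) /= DE|S].
  apply/se_filter_eq/seteqP; split=> x /filter_nucleus_topE xt;
    apply/filter_nucleus_topE/eqP; rewrite -top_le -xt;
    move: x {xt}; apply/nle_fix; by rewrite DE.
have [I [c Sc]] := fittedP S; pose j := nsup (fun i => open_nucleus (c i)).
exists (nucleus_filter j); apply: fitted_eq; rewrite /= Sc -fix_nsup -/j.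
apply/seteqP; split; apply/nle_fix; last exact/filter_nucleus_nle.
apply: nsup_least => i; apply/open_nle/filter_nucleus_top.
suff jc : j (c i) = \top by [].
by apply/open_nle; exact: (nsup_ub (fun i => open_nucleus (c i))).
Qed.

Theorem theorem3p6 (L : frame) :
  (exists exactD : forall D : se_filter L,
       short_exact (filter_incl D) (filter_quo D),
     let Phi (D : se_filter L) := ext_of (Ses (exactD D)) in
     bijective Phi /\
     (forall (s : ses (frame_form L)) (D : se_filter L),
        ext_of s = Phi D -> range (ses_inj s) = sef_set D)) /\
  (exists fittedD : forall D : se_filter L,
       is_sublocale (fix_set (filter_nucleus (sef_set D))) /\
       exists (I : Type) (c : I -> L),
         fix_set (filter_nucleus (sef_set D)) =
         \bigcap_(i in [set: I]) open_sublocale (c i),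
     bijective (fun D : se_filter L =>
       Fitted (proj1 (fittedD D)) (proj2 (fittedD D)))).
Proof.
split; last by exists (@filter_fitted L); exact: fitted_bij.
exists (@filter_short_exact L); split; first exact: ext_of_bij.
exact: ext_of_range.
Qed.
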